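(* Let $\alpha<\tfrac14$. Every $\epsilon$-differentially private $(\alpha,\beta=\tfrac12)$-PAC $k$-learner for $\operatorname{PAR}_d$ under the uniform distribution requires sample complexity $\Omega(kd/\epsilon)$.
   Context: $\operatorname{PAR}_d=\{c_x : x\in\{0,1\}^d\}$ with $c_x(y)=\langle x,y\rangle\bmod 2$, functions on $\{0,1\}^d$; $U_d$ is the uniform distribution on $\{0,1\}^d$. An algorithm $\mathcal A$ taking a $k$-labeled database (element of $(\{0,1\}^d\times\{0,1\}^k)^n$) and outputting $k$ hypotheses $(h_1,\dots,h_k)$ (arbitrary functions $\{0,1\}^d\to\{0,1\}$) is an $(\alpha,\beta)$-PAC $k$-learner for $\operatorname{PAR}_d$ under the uniform distribution with sample complexity $n$ if for every $c_1,\dots,c_k\in\operatorname{PAR}_d$, given $S=((x_i,c_1(x_i),\dots,c_k(x_i)))_{i=1}^n$ with $x_i$ i.i.d. from $U_d$, $\Pr[\max_j\Pr_{x\sim U_d}[h_j(x)\neq c_j(x)]>\alpha]\leq\beta$. Two databases of the same size are neighboring if they differ in one entry; $\epsilon$-differential privacy means $\Pr[\mathcal A(S)\in T]\le e^\epsilon\Pr[\mathcal A(S')\in T]$ for all neighboring $S,S'$ and output sets $T$.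
   Formalization: The bound is stated for kd ≥ 2: for k = d = 1 it fails, since with sample complexity 0 a uniformly random guess between the two parities is ε-differentially private for every ε and fails with probability exactly 1/2. *)

(* Defs.v *)
From HB Require Import structures.
From mathcomp Require Import all_boot all_order all_algebra.
From mathcomp Require Import reals sequences exp.

Set Implicit Arguments.
Unset Strict Implicit.
Unset Printing Implicit Defensive.

Import Order.TTheory GRing.Theory Num.Theory.
Local Open Scope ring_scope.

Record fdist (R : realType) (T : finType) := FDist {
  pmf :> {ffun T -> R};
  pmf_ge0 : forall x, 0 <= pmf x;
  pmf_sum1 : \sum_x pmf x = 1
}.

Definition Pr (R : realType) (T : finType) (p : fdist R T) (E : {set T}) : R :=
  \sum_(x in E) p x.

(* The distribution of the output of [f x] when [x] is drawn from [p]. *)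
Section Bind.
Variables (R : realType) (T U : finType) (p : fdist R T) (f : T -> fdist R U).

Definition bind_pmf : {ffun U -> R} := [ffun y => \sum_x p x * f x y].

Lemma bind_pmf_ge0 y : 0 <= bind_pmf y.
Proof.
by rewrite ffunE; apply: sumr_ge0 => x _; apply: mulr_ge0; apply: pmf_ge0.
Qed.

Lemma bind_pmf_sum1 : \sum_y bind_pmf y = 1.
Proof.
under eq_bigr do rewrite ffunE.
rewrite exchange_big /=.
under eq_bigr do rewrite -mulr_sumr pmf_sum1 mulr1.
exact: pmf_sum1.
Qed.

Definition bind : fdist R U := FDist bind_pmf_ge0 bind_pmf_sum1.
End Bind.

(* The law of [n] independent draws from [p]. *)
Section Iid.
Variables (R : realType) (T : finType) (n : nat) (p : fdist R T).

Definition iid_pmf : {ffun {ffun 'I_n -> T} -> R} :=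
  [ffun xs : {ffun 'I_n -> T} => \prod_i p (xs i)].

Lemma iid_pmf_ge0 xs : 0 <= iid_pmf xs.
Proof. by rewrite ffunE; apply: prodr_ge0 => i _; apply: pmf_ge0. Qed.

Lemma iid_pmf_sum1 : \sum_xs iid_pmf xs = 1.
Proof.
under eq_bigr do rewrite ffunE.
rewrite -(bigA_distr_bigA (fun=> p)) /=.
by apply: big1 => i _; apply: pmf_sum1.
Qed.

Definition iid : fdist R {ffun 'I_n -> T} := FDist iid_pmf_ge0 iid_pmf_sum1.
End Iid.

Definition cube (d : nat) : finType := {ffun 'I_d -> bool}.

Definition concept (d : nat) : finType := {ffun cube d -> bool}.

Section UniformCube.
Variables (R : realType) (d : nat).

Definition unif_pmf : {ffun cube d -> R} := [ffun=> #|cube d|%:R^-1].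

Lemma unif_pmf_ge0 x : 0 <= unif_pmf x.
Proof. by rewrite ffunE invr_ge0 ler0n. Qed.

Lemma unif_pmf_sum1 : \sum_x unif_pmf x = 1.
Proof.
under eq_bigr do rewrite ffunE.
rewrite sumr_const -[LHS]mulr_natl mulfV // pnatr_eq0 -lt0n.
by apply/card_gt0P; exists [ffun=> false].
Qed.

Definition unif_cube : fdist R (cube d) := FDist unif_pmf_ge0 unif_pmf_sum1.
End UniformCube.

Definition parity (d : nat) (x : cube d) : concept d :=
  [ffun y : cube d => odd (\sum_(i < d) x i * y i)%N].

Definition PAR (d : nat) : {set concept d} := [set parity x | x : cube d].

Definition database (X : finType) (n : nat) : finType := {ffun 'I_n -> X}.

Definition neighboring (X : finType) (n : nat) (S S' : database X n) : Prop :=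
  #|[set i | S i != S' i]| = 1%N.

Definition differentially_private (R : realType) (X Y : finType) (n : nat)
    (eps : R) (A : database X n -> fdist R Y) : Prop :=
  forall S S' : database X n, neighboring S S' ->
  forall T : {set Y}, Pr (A S) T <= expR eps * Pr (A S') T.

Definition labeled (k d : nat) : finType := (cube d * cube k)%type.

Definition hypotheses (k d : nat) : finType := {ffun 'I_k -> concept d}.

Definition label (k d n : nat) (c : hypotheses k d)
    (xs : {ffun 'I_n -> cube d}) : database (labeled k d) n :=
  [ffun i => (xs i, [ffun j => c j (xs i)])].

Definition error (R : realType) (d : nat) (h c : concept d) : R :=
  Pr (unif_cube R d) [set x | h x != c x].

(* Errors are nonnegative, so the default value 0 of the maximum only matters
   when k = 0. *)
Definition max_error (R : realType) (k d : nat) (h c : hypotheses k d) : R :=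
  \big[Num.max/0]_(j < k) error R (h j) (c j).

Definition PAC_klearner_unif (R : realType) (k d n : nat)
    (C : {set concept d}) (alpha beta : R)
    (A : database (labeled k d) n -> fdist R (hypotheses k d)) : Prop :=
  forall c : hypotheses k d, (forall j, c j \in C) ->
  Pr (bind (iid n (unif_cube R d)) (fun xs => A (label c xs)))
     [set h | alpha < max_error R h c] <= beta.

(* Main.v *)
Require Import Defs.
From HB Require Import structures.
From mathcomp Require Import all_boot all_order all_algebra.
From mathcomp Require Import reals sequences exp.
From mathcomp Require Import lra.

(** A packing argument. Two distinct parities disagree on exactly half of the
    cube, so the [2 ^ (k * d)] tuples of parities have pairwise disjoint balls
    of radius [alpha < 1/4] for the maximal error. Relabelling a database of
    size [n] changes at most [n] entries, so by group privacy the learner run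
    on data labelled by one fixed tuple hits each ball with probability at
    least [exp (- eps * n) / 2]. These probabilities sum to at most [1], whence
    [(k * d - 1) * ln 2 <= eps * n]. *)

Set Implicit Arguments.
Unset Strict Implicit.
Unset Printing Implicit Defensive.

Import Order.TTheory GRing.Theory Num.Theory.
Local Open Scope ring_scope.

Section FiniteProbability.
Variable R : realType.

Lemma Pr_ge0 (T : finType) (p : fdist R T) (E : {set T}) : 0 <= Pr p E.
Proof. by apply: sumr_ge0 => x _; apply: pmf_ge0. Qed.

Lemma Pr_setC (T : finType) (p : fdist R T) (E : {set T}) :
  Pr p (~: E) = 1 - Pr p E.
Proof.
rewrite -(pmf_sum1 p) (bigID (mem E)) /= /Pr addrC addrK.
by apply: eq_bigl => x; rewrite inE.
Qed.

Lemma Pr_setU_le (T : finType) (p : fdist R T) (A B E : {set T}) :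
  E \subset A :|: B -> Pr p E <= Pr p A + Pr p B.
Proof.
move=> /subsetP sub; rewrite /Pr big_mkcond [X in _ <= X + _]big_mkcond.
rewrite [X in _ <= _ + X]big_mkcond -big_split /=.
apply: ler_sum => x _; have := pmf_ge0 p x; have := sub x.
rewrite inE; case: (x \in E) (x \in A) (x \in B) => -[] [] //= h; lra.
Qed.

Lemma Pr_bind (T U : finType) (p : fdist R T) (f : T -> fdist R U)
    (E : {set U}) :
  Pr (bind p f) E = \sum_x p x * Pr (f x) E.
Proof.
rewrite /Pr /=; under eq_bigr do rewrite ffunE.
by rewrite exchange_big /=; apply: eq_bigr => x _; rewrite mulr_sumr.
Qed.

(** After exchanging the two sums, each outcome [h] is weighted by the number of sets [B i]
    containing it, which is at most one. *)
Lemma sum_Pr_disjoint_le1 (I T : finType) (p : fdist R T) (B : I -> {set T}) :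
  (forall i j h, h \in B i -> h \in B j -> i = j) -> \sum_i Pr p (B i) <= 1.
Proof.
move=> disjB; rewrite /Pr (exchange_big_dep predT) //= -(pmf_sum1 p).
apply: ler_sum => h _; rewrite sumr_const.
have le1 : (#|[pred i | h \in B i]| <= 1)%N.
  by apply/card_le1P => i hi j; rewrite !inE; apply/idP/eqP => [hj|->//];
    apply: disjB hj hi.
by rewrite -[leRHS]mulr1n ler_wpMn2l // pmf_ge0.
Qed.

End FiniteProbability.

Section GroupPrivacy.
Variables (R : realType) (X Y : finType) (n : nat) (eps : R).
Variable A : database X n -> fdist R Y.
Hypothesis privA : differentially_private eps A.

(** Induction on the Hamming distance: copying a single differing entry of [S'] into [S] gives a
    neighbor [S1] of [S] that is one step closer to [S'], at the cost of one factor [expR eps]. *)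
Lemma group_privacy_diff m (S S' : database X n) (T : {set Y}) :
  #|[set i | S i != S' i]| = m ->
  Pr (A S) T <= expR (eps * m%:R) * Pr (A S') T.
Proof.
elim: m S => [|m IHm] S diffSS'.
  have -> : S = S'.
    apply/ffunP => i; apply/eqP/negbNE.
    by have /setP/(_ i) := cards0_eq diffSS'; rewrite !inE => ->.
  by rewrite mulr0 expR0 mul1r.
have [i Si] : exists i, S i != S' i.
  have /card_gt0P[i] : (0 < #|[set i | S i != S' i]|)%N by rewrite diffSS'.
  by rewrite inE; exists i.
pose S1 : database X n := [ffun j => if j == i then S' i else S j].
have nbr : neighboring S S1.
  rewrite /neighboring -(cards1 i); congr #|pred_of_set _|; apply/setP => j.
  by rewrite !inE ffunE; case: (j =P i) => [->|_] //; rewrite eqxx.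
have diffS1 : #|[set j | S1 j != S' j]| = m.
  move: diffSS'; rewrite (cardsD1 i) inE Si add1n => -[<-].
  congr #|pred_of_set _|; apply/setP => j.
  by rewrite !inE ffunE; case: (j =P i) => [->|_] //; rewrite eqxx.
apply: le_trans (privA nbr T) _.
rewrite -natr1 mulrDr mulr1 addrC expRD -mulrA.
by rewrite ler_wpM2l ?expR_ge0 // IHm.
Qed.

Lemma group_privacy (S S' : database X n) (T : {set Y}) :
  0 <= eps -> Pr (A S) T <= expR (eps * n%:R) * Pr (A S') T.
Proof.
move=> eps0; apply: le_trans (group_privacy_diff (S' := S') T erefl) _.
rewrite ler_wpM2r ?Pr_ge0 // ler_expR ler_wpM2l // ler_nat.
by rewrite -[leqRHS]card_ord max_card.
Qed.

End GroupPrivacy.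

Section ParityDistance.
Variables (R : realType) (d : nat).

Definition flip (i : 'I_d) (y : cube d) : cube d :=
  [ffun j => (j == i) (+) y j].

Lemma flipK i : involutive (flip i).
Proof. by move=> y; apply/ffunP => j; rewrite !ffunE addKb. Qed.

Lemma parity_flip (x y : cube d) i : parity x (flip i y) = x i (+) parity x y.
Proof.
rewrite !ffunE (bigD1 i) //= [in RHS](bigD1 i) //= !oddD ffunE eqxx.
rewrite (eq_bigr (fun j => x j * y j)%N) => [|j /negbTE ji]; last first.
  by rewrite ffunE ji.
by rewrite addbA; congr addb; case: (x i) (y i) => -[].
Qed.

(** Flipping a coordinate where [x] and [x'] differ changes exactly one of the two parities. This
    involution of the cube swaps agreement with disagreement, so both sets have the same
    probability. *)
Lemma error_parity (x x' : cube d) :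
  x != x' -> error R (parity x) (parity x') = 1 / 2.
Proof.
move=> xx'; have [i xi] : exists i, x i != x' i.
  apply/existsP; apply: contraR xx' => /existsPn eqx.
  by apply/eqP/ffunP => i; apply/eqP/negbNE.
have eqC : error R (parity x) (parity x') =
    Pr (unif_cube R d) (~: [set y | parity x y != parity x' y]).
  rewrite /error /Pr (reindex_inj (inv_inj (flipK i))) /=.
  apply: eq_big => [y|y _]; last by rewrite !ffunE.
  rewrite !inE !parity_flip.
  by move: xi; case: (x i) (x' i) (parity x y) (parity x' y) => -[] [] [].
by move: eqC; rewrite Pr_setC -/(error _ _ _); lra.
Qed.

Lemma error_triangle (h c c' : concept d) :
  error R c c' <= error R h c + error R h c'.
Proof.
apply: Pr_setU_le; apply/subsetP => y; rewrite !inE.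
by case: (h y) (c y) (c' y) => -[] [].
Qed.

End ParityDistance.

Definition parities (k d : nat) (f : {ffun 'I_k -> cube d}) : hypotheses k d :=
  [ffun j => parity (f j)].

Lemma error_le_max (R : realType) k d (h c : hypotheses k d) j :
  error R (h j) (c j) <= max_error R h c.
Proof. exact: (le_bigmax_cond _ (fun j => error R (h j) (c j))). Qed.

(** If [f j] and [g j] differed, the triangle inequality through [h j] would give
    [1 / 2 <= 2 * alpha < 1 / 2]. *)
Lemma parities_packing (R : realType) (alpha : R) k d (h : hypotheses k d) f g :
  alpha < 1 / 4 ->
  max_error R h (parities f) <= alpha -> max_error R h (parities g) <= alpha ->
  f = g.
Proof.
move=> alpha_lt hf hg; apply/ffunP => j; apply/eqP/negbNE/negP => fg.
have := error_triangle R (h j) (parities f j) (parities g j).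
have := le_trans (error_le_max R h _ j) hf.
have := le_trans (error_le_max R h _ j) hg.
rewrite !ffunE error_parity //; lra.
Qed.

Theorem theorem5p4 (R : realType) :
  exists2 c0 : R, 0 < c0 &
  forall (alpha : R), alpha < 1 / 4 ->
  forall (k d : nat), (1 < k * d)%N ->
  forall (eps : R), 0 < eps ->
  forall (n : nat) (A : database (labeled k d) n -> fdist R (hypotheses k d)),
    differentially_private eps A ->
    PAC_klearner_unif (PAR d) alpha (1 / 2) A ->
    c0 * (k * d)%:R / eps <= n%:R.
Proof.
have ln2_gt0 : 0 < ln 2 :> R by rewrite ln_gt0 // ltr1n.
exists (ln 2 / 2); first by rewrite divr_gt0.
move=> alpha alpha_lt k d kd_gt1 eps eps_gt0 n A privA learnA.
pose P c := bind (iid n (unif_cube R d)) (fun xs => A (label c xs)).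
(* As the complement of the failure event, the ball has probability at least [1 - 1 / 2] under
   [P (parities f)]. *)
pose ball f := ~: [set h | alpha < max_error R h (@parities k d f)].
pose f0 : {ffun 'I_k -> cube d} := [ffun=> [ffun=> false]].
have half_le f : 1 / 2 <= expR (eps * n%:R) * Pr (P (parities f0)) (ball f).
  have le_f0 : Pr (P (parities f)) (ball f) <=
      expR (eps * n%:R) * Pr (P (parities f0)) (ball f).
    (* Both laws draw the same sample points, so the comparison is made for each fixed [xs], where
       only the labels differ. *)
    rewrite !Pr_bind mulr_sumr; apply: ler_sum => xs _.
    rewrite mulrCA ler_wpM2l ?pmf_ge0 //.
    by apply: group_privacy => //; apply: ltW.
  apply: le_trans le_f0; rewrite Pr_setC.
  have inPAR j : parities f j \in PAR d by rewrite ffunE imset_f.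
  by have := learnA _ inPAR; rewrite -/(P _); lra.
have disj f g h : h \in ball f -> h \in ball g -> f = g.
  by rewrite !inE -!leNgt; apply: parities_packing.
have card_le : (2 ^ (k * d))%:R / 2 <= expR (eps * n%:R).
  have -> : (2 ^ (k * d))%N = #|{ffun 'I_k -> cube d}|.
    by rewrite !card_ffun !card_ord card_bool -expnM mulnC.
  rewrite -[leRHS]mulr1.
  apply: le_trans (ler_wpM2l (expR_ge0 _)
                     (sum_Pr_disjoint_le1 (P (parities f0)) disj)).
  (* The left side becomes the sum of [1 / 2] over all [f], and [half_le] applies termwise. *)
  rewrite mulr_sumr -[_ / 2]mul1r mulrCA mulr_natl -sumr_const.
  exact: ler_sum.
have kd_ge2 : 2 <= (k * d)%:R :> R by rewrite ler_nat.
have : ((k * d)%:R - 1) * ln 2 <= eps * n%:R.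
  rewrite -[leRHS]expRK mulrBl mul1r mulr_natl -lnXn // -ln_div ?posrE //.
    by rewrite -natrX ler_ln ?posrE ?expR_gt0 // divr_gt0 // ltr0n expn_gt0.
  exact: exprn_gt0.
(* The constant [ln 2 / 2] comes from here: [k * d >= 2] gives [k * d - 1 >= (k * d) / 2]. *)
rewrite ler_pdivrMr // [_ * eps]mulrC; apply: le_trans.
nra.
Qed.
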